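(* Let $m\le n$ be positive integers, let $\mathbf{a}=(a_1,\dots,a_m)$ be integers with $n=a_1>a_2>\cdots>a_m\ge 1$, and let $\boldsymbol{\varepsilon}=(\varepsilon_1,\dots,\varepsilon_m)\in\{0,1\}^m$. For $0\le k\le n$, let $f(\mathbf{a},\boldsymbol{\varepsilon},k)$ be the number of nonintersecting chord diagrams $F$ in the multiset $\mathcal{NCD}(E(\mathbf{a},\boldsymbol{\varepsilon}))$ (counted with multiplicity) with $e_F(Y)+e_F(X\cup Z)=k$. Let $g(\mathbf{a},\boldsymbol{\varepsilon},k)$ be the number of $0$-$1$ Young diagrams $M$ of shape $\mathbf{a}$ such that (1) every column of $M$ contains at most one $1$; (2) for each $1\le i\le m$, the number of $1$'s in the $i$th row of $M$ is congruent to $\varepsilon_i$ modulo $2$; (3) $M$ contains exactly $k$ entries equal to $1$. Then $f(\mathbf{a},\boldsymbol{\varepsilon},k)=g(\mathbf{a},\boldsymbol{\varepsilon},k)$.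
   Context: A chord is a line segment whose endpoints lie on a circle; a chord diagram is a set of chords no two of which share an endpoint. A crossing is a pair of chords that intersect in the interior of the disk; a chord diagram is nonintersecting if it has no crossing. If $E$ has a crossing $S=\{ac,bd\}$ where $a,b,c,d$ appear in this cyclic order on the circle, the chord expansion of $E$ with respect to $S$ replaces $E$ by the two chord diagrams $E_1=(E\setminus S)\cup\{ab,cd\}$ and $E_2=(E\setminus S)\cup\{da,bc\}$. Iterating expansions until no crossings remain yields a multiset of nonintersecting chord diagrams, which is known to be independent of the choices of expansions; it is denoted $\mathcal{NCD}(E)$. For a chord diagram $F$ and a set $U$ of points, $e_F(U)$ is the number of chords of $F$ with both endpoints in $U$. Construction of $E(\mathbf{a},\boldsymbol{\varepsilon})$: take points $X=\{x_1,\dots,x_m\}$, $Y=\{y_1,\dots,y_n\}$, $Z=\{z_1,\dots,z_n\}$ placed on the circle in the anticlockwise order $x_1,x_2,\dots,x_m,z_1,z_2,\dots,z_n,y_n,y_{n-1},\dots,y_1$. Then $E(\mathbf{a},\boldsymbol{\varepsilon})=\{x_iy_{a_i}: \varepsilon_i=0\}\cup\{x_iz_{a_i}:\varepsilon_i=1\}\cup\{y_jz_j: j\in\{1,\dots,n\}\setminus\{a_1,\dots,a_m\}\}$, a chord diagram with $n$ chords (unused points are ignored). A $0$-$1$ Young diagram of shape $\mathbf{a}$ is a Young diagram with rows of lengths $a_1,\dots,a_m$ (left-justified, English convention) in which each box holds a value $0$ or $1$. *)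

(* Defs.v *)
From mathcomp Require Import all_boot.
Set Implicit Arguments. Unset Strict Implicit. Unset Printing Implicit Defensive.

(* Points on the circle are encoded by their position 0,1,2,... in the
   anticlockwise order  x_1,...,x_m, z_1,...,z_n, y_n,...,y_1.
   A chord is a pair (p,q) of positions with p < q; a chord diagram is a
   list of chords. *)

Definition posX (i : nat) : nat := i.-1.               (* x_i, 1 <= i <= m *)
Definition posZ (m j : nat) : nat := m + j - 1.         (* z_j, 1 <= j <= n *)
Definition posY (m n j : nat) : nat := m + 2 * n - j.   (* y_j, 1 <= j <= n *)

Definition inX (m : nat) (p : nat) : bool := p < m.
Definition inZ (m n : nat) (p : nat) : bool := (m <= p) && (p < m + n).
Definition inY (m n : nat) (p : nat) : bool := (m + n <= p) && (p < m + 2 * n).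

Definition chord := (nat * nat)%type.
Definition diagram := seq chord.

Definition crosses (c d : chord) : bool := (c.1 < d.1) && (d.1 < c.2) && (c.2 < d.2).

Definition noncrossing (E : diagram) : bool :=
  all (fun c => all (fun d => ~~ crosses c d) E) E.

(* full_expansion E M : M (a list = multiset of nonintersecting diagrams) is
   obtained from E by iterating chord expansions until no crossings remain.
   For a crossing S = {ac, bd} with a<b<c<d, E1 = (E\S) u {ab, cd} and
   E2 = (E\S) u {da, bc}. *)
Inductive full_expansion : diagram -> seq diagram -> Prop :=
| fe_done (E : diagram) : noncrossing E -> full_expansion E [:: E]
| fe_step (E rest : diagram) (a b c d : nat) (M1 M2 : seq diagram) :
    perm_eq E ((a, c) :: (b, d) :: rest) ->
    a < b -> b < c -> c < d ->
    full_expansion ((a, b) :: (c, d) :: rest) M1 ->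
    full_expansion ((a, d) :: (b, c) :: rest) M2 ->
    full_expansion E (M1 ++ M2).

Definition eF (U : pred nat) (F : diagram) : nat :=
  count (fun c => U c.1 && U c.2) F.

Definition Eae (m n : nat) (a : seq nat) (eps : seq bool) : diagram :=
  [seq (posX i, if nth false eps i.-1 then posZ m (nth 0 a i.-1)
                 else posY m n (nth 0 a i.-1)) | i <- iota 1 m]
  ++ [seq (posZ m j, posY m n j) | j <- iota 1 n & j \notin a].

Definition fcount (m n : nat) (M : seq diagram) (k : nat) : nat :=
  count (fun F => eF (inY m n) F + eF (fun p => inX m p || inZ m n p) F == k) M.

(* 0-1 Young diagrams of shape a: functions on boxes (i, c), row i < m
   (0-based), column c < n (0-based), with value false (= 0) outside the shape
   (i.e. for c >= a_{i+1}); these are in bijection with fillings of the shape. *)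
Definition youngOK (m n : nat) (a : seq nat) (eps : seq bool) (k : nat)
  (M : {ffun 'I_m * 'I_n -> bool}) : bool :=
  [&& [forall i : 'I_m, forall c : 'I_n, (nth 0 a i <= c) ==> ~~ M (i, c)],
      [forall c : 'I_n, #|[set i : 'I_m | M (i, c)]| <= 1],
      [forall i : 'I_m, odd #|[set c : 'I_n | M (i, c)]| == nth false eps i] &
      #|[set b | M b]| == k].

Definition gcount (m n : nat) (a : seq nat) (eps : seq bool) (k : nat) : nat :=
  #|[set M : {ffun 'I_m * 'I_n -> bool} | @youngOK m n a eps k M]|.

(* Main.v *)
Require Import Defs.
From mathcomp Require Import all_boot all_order all_algebra zify ring.
Set Implicit Arguments. Unset Strict Implicit. Unset Printing Implicit Defensive.
Import GRing.Theory.

(* Attach a number [s p] to every point: the product of [s p - s q] over the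
   chords [(p, q)] is additive under chord expansion (Ptolemy), and for 0-1
   valued [s] these functionals are triangular on nonintersecting diagrams, the
   latter being determined by their openers.  So any full expansion of a diagram
   gives the same multiset, and one convenient sequence of expansions suffices.
   A diagram of the family is read as a word of columns 1, ..., n: F for a free
   chord [z_j y_j], R0 for [x_i y_j] and R1 for [x_i z_j] with [j = a_i].  Expanding
   a crossing of adjacent columns, and removing chords that cannot cross anything
   with a weight X when both their endpoints are in Y or both are in X and Z, gives
   the rules  F R0 = R0 F + X R1,  F R1 = R1 F + X R0  and, at the head of the word,
   R1 w = X w,  R0 w = F w.  The same rules hold for the Young diagrams: with one
   sign per row to detect parities, column [c] contributes the factor
   [1 + X * (sum of the signs of the rows longer than c)]. *)

(** * Uniqueness of the full expansion *)

Definition endpoints (E : diagram) : seq nat := map fst E ++ map snd E.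

(** A [diagram] is any list of pairs; this restores that chords share no endpoint and are written
    with the smaller position first. *)
Definition proper_diagram (E : diagram) : bool :=
  uniq (endpoints E) && all (fun c => c.1 < c.2) E.

Lemma perm_endpoints E E' : perm_eq E E' -> perm_eq (endpoints E) (endpoints E').
Proof. by move=> h; apply: perm_cat; apply: perm_map. Qed.

Lemma perm_proper_diagram E E' : perm_eq E E' -> proper_diagram E = proper_diagram E'.
Proof.
by move=> h; rewrite /proper_diagram (perm_uniq (perm_endpoints h)) (perm_all _ h).
Qed.

Lemma mem_noncrossing E c d :
  noncrossing E -> c \in E -> d \in E -> ~~ crosses c d.
Proof. by move=> /allP h /h /allP; apply. Qed.

Lemma perm_noncrossing E E' : perm_eq E E' -> noncrossing E -> noncrossing E'.
Proof.
move=> h nc; apply/allP=> c cE; apply/allP=> d dE.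
by apply: (mem_noncrossing nc); rewrite (perm_mem h).
Qed.

Lemma endpoints_switch (a b c d a' b' c' d' : nat) rest :
  perm_eq [:: a; b; c; d] [:: a'; b'; c'; d'] ->
  perm_eq (endpoints ((a, c) :: (b, d) :: rest))
          (endpoints ((a', c') :: (b', d') :: rest)).
Proof.
move=> h; have E x y z t : perm_eq (endpoints ((x, z) :: (y, t) :: rest))
    ([:: x; y; z; t] ++ endpoints rest).
  rewrite /endpoints /= !perm_cons perm_sym.
  by apply/permP=> P; rewrite /= !count_cat /=; lia.
by rewrite (permPl (E _ _ _ _)) perm_sym (permPl (E _ _ _ _)) perm_cat2r perm_sym.
Qed.

Lemma full_expansion_endpoints E M : full_expansion E M ->
  forall F, F \in M -> perm_eq (endpoints F) (endpoints E).
Proof.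
elim=> {E M} [E _ F|E rest a b c d M1 M2 hE _ _ _ _ IH1 _ IH2 F].
  by rewrite inE => /eqP ->.
rewrite mem_cat (permPr (perm_endpoints hE)) => /orP[] /[dup] FM.
  move=> /IH1 h; apply: (perm_trans h); apply: endpoints_switch.
  by apply/permP=> P /=; lia.
move=> /IH2 h; apply: (perm_trans h); apply: endpoints_switch.
by apply/permP=> P /=; lia.
Qed.

Lemma full_expansion_proper E M : full_expansion E M -> proper_diagram E ->
  forall F, F \in M -> proper_diagram F.
Proof.
elim=> {E M} [E _ pE F|E rest a b c d M1 M2 hE ab bc cd _ IH1 _ IH2 pE F].
  by rewrite inE => /eqP ->.
move: pE; rewrite (perm_proper_diagram hE) => /andP[u /= /and3P[_ _ r]].
rewrite mem_cat => /orP[]; [apply: IH1 | apply: IH2]; apply/andP; split.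
- by rewrite (perm_uniq (endpoints_switch _ (a' := a) (b' := b) (c' := c) (d' := d) _)) //;
    apply/permP=> P /=; lia.
- by rewrite /= r ab cd.
- by rewrite (perm_uniq (endpoints_switch _ (a' := a) (b' := b) (c' := c) (d' := d) _)) //;
    apply/permP=> P /=; lia.
- by rewrite /= r bc (ltn_trans ab (ltn_trans bc cd)).
Qed.

Lemma full_expansion_noncrossing E M : full_expansion E M -> all noncrossing M.
Proof.
by elim=> {E M} [E /= ->//|E rest a b c d M1 M2 _ _ _ _ _ h1 _ h2]; rewrite all_cat h1.
Qed.

Definition chord_eval (s : pred nat) (E : diagram) : int :=
  (\prod_(c <- E) ((s c.1)%:R - (s c.2)%:R))%R.

Lemma perm_chord_eval s E E' : perm_eq E E' -> chord_eval s E = chord_eval s E'.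
Proof. exact: perm_big. Qed.

(* The Ptolemy identity for the differences [s p - s q]. *)
Lemma full_expansion_chord_eval s E M : full_expansion E M ->
  chord_eval s E = (\sum_(F <- M) chord_eval s F)%R.
Proof.
elim=> {E M} [E _|E rest a b c d M1 M2 hE _ _ _ _ IH1 _ IH2].
  by rewrite big_seq1.
by rewrite big_cat /= -IH1 -IH2 (perm_chord_eval _ hE) /chord_eval !big_cons /=; ring.
Qed.

Definition opens (E : diagram) : pred nat := fun p => p \in map fst E.

(** The order in which the evaluations at sets of openers form a triangular system. *)
Definition weight (E : diagram) : nat := \sum_(c <- E) c.1.

Lemma proper_opens E c : proper_diagram E -> c \in E -> opens E c.1 && ~~ opens E c.2.
Proof.
case/andP; rewrite cat_uniq => /and3P[_ /hasPn h _] _ cE.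
by rewrite /opens map_f //=; apply: h; apply: map_f.
Qed.

Lemma chord_eval_opens E : proper_diagram E -> chord_eval (opens E) E = 1%R.
Proof.
move=> pE; rewrite /chord_eval big_seq big1 // => c /(proper_opens pE) /andP[-> /negbTE ->].
by [].
Qed.

(* Triangularity: in [E'] exactly one endpoint of each chord opens in [E], and
   the openers of [E'] are the smallest possible choice. *)
Lemma chord_eval_opens_neq0 E E' : proper_diagram E -> proper_diagram E' ->
  perm_eq (endpoints E) (endpoints E') -> chord_eval (opens E) E' != 0%R ->
  weight E <= weight E' -> perm_eq (map fst E) (map fst E').
Proof.
move=> pE pE' hp nz.
have sE : weight E = \sum_(p <- endpoints E | opens E p) p.
  have z : \sum_(c <- E | opens E c.2) c.2 = 0.
    rewrite big_seq_cond big1 // => c /andP[cE].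
    by case/andP: (proper_opens pE cE) => _ /negbTE ->.
  rewrite big_cat /= !big_map z addn0 /weight [LHS]big_seq [RHS]big_seq_cond.
  apply: eq_bigl => c; case cE: (c \in E) => //=.
  by case/andP: (proper_opens pE cE).
have sE' : \sum_(p <- endpoints E | opens E p) p =
   \sum_(c <- E') (opens E c.1 * c.1 + opens E c.2 * c.2).
  rewrite (perm_big _ hp) big_cat /= !big_map big_split /=.
  by congr addn; rewrite big_mkcond /=; apply: eq_bigr => c _; case: ifP; rewrite ?mul1n.
(* Otherwise the factor of [c] in the evaluation would be zero. *)
have hx c : c \in E' -> opens E c.1 != opens E c.2.
  move=> cE; apply: contra nz => /eqP h; apply/eqP.
  rewrite /chord_eval (perm_big _ (perm_to_rem cE)).
  by rewrite big_cons h subrr /= mul0r.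
have lt c : c \in E' -> c.1 < c.2 by case/andP: pE' => _ /allP h /h.
rewrite sE sE' => hle.
(* Each chord of [E'] contributes exactly one endpoint to the weight of [E]; if that were ever the
   larger one, [E] would be strictly heavier than [E']. *)
have all1 c : c \in E' -> opens E c.1.
  move=> cE; apply: contraLR hle => o1; rewrite -ltnNge /weight.
  rewrite !(perm_big _ (perm_to_rem cE)) /= !big_cons.
  have := hx _ cE; rewrite (negbTE o1); case: (opens E c.2) => // _.
  rewrite mul0n mul1n add0n -addSn; apply: leq_add; first exact: lt.
  rewrite big_seq [X in _ <= X]big_seq; apply: leq_sum => d /mem_rem dE.
  have := hx _ dE; have := lt _ dE.
  by case: (opens E d.1) (opens E d.2) => [] [] //=; lia.
have [u u'] : uniq (map fst E) /\ uniq (map fst E').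
  case/andP: pE; rewrite cat_uniq => /andP[-> _] _.
  by case/andP: pE'; rewrite cat_uniq => /andP[-> _] _.
have sub : {subset map fst E' <= map fst E} by move=> p /mapP[c cE ->]; exact: all1.
have sz : size (map fst E) <= size (map fst E').
  by have := perm_size hp; rewrite /endpoints !size_cat !size_map; lia.
have [eqsz heq] := uniq_min_size u' sub sz.
by apply: uniq_perm => // p; rewrite heq.
Qed.

Lemma proper_cons c E : proper_diagram (c :: E) -> proper_diagram E.
Proof.
case/andP=> u /= /andP[_ h]; rewrite /proper_diagram h andbT; apply: subseq_uniq u.
by apply: cat_subseq; apply: subseq_cons.
Qed.

Lemma noncrossing_cons c E : noncrossing (c :: E) -> noncrossing E.
Proof.
move=> h; apply/allP=> d dE; apply/allP=> e eE.
by apply: (mem_noncrossing h); rewrite inE ?dE ?eE orbT.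
Qed.

(* The largest opener [p] is matched with the first closer after it. *)
Lemma max_opener_closer p q E r :
  proper_diagram ((p, q) :: E) -> noncrossing ((p, q) :: E) ->
  (forall c, c \in E -> c.1 <= p) -> r \in map snd ((p, q) :: E) -> p < r -> q <= r.
Proof.
move=> pE nc mx; rewrite inE => /orP[/eqP -> //|/mapP[c cE ->]] pr.
have cp : c.1 < p.
  rewrite ltn_neqAle mx // andbT; apply/eqP=> h.
  by case/andP: pE; rewrite /endpoints /= mem_cat -h map_f.
have := mem_noncrossing nc (c := c) (d := (p, q)); rewrite !inE cE eqxx orbT.
by move=> /(_ isT isT); rewrite /crosses /= cp pr /= -leqNgt.
Qed.

(** Induction on the number of chords: the chord with the largest opener must end at the first
    closer after it, so it is the same in both diagrams and can be removed. *)
Lemma noncrossing_openers E E' : proper_diagram E -> proper_diagram E' ->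
  noncrossing E -> noncrossing E' ->
  perm_eq (endpoints E) (endpoints E') -> perm_eq (map fst E) (map fst E') ->
  perm_eq E E'.
Proof.
have [k] := ubnP (size E); elim: k E E' => // k IH E E' lek pE pE' nE nE' hp hf.
have hs : perm_eq (map snd E) (map snd E').
  by rewrite -(perm_cat2l (map fst E)) (permPl hp) perm_cat2r perm_sym.
case: (posnP (size E)) => [/eqP|szE].
  move/eqP/size0nil => E0; move: hf; rewrite E0 perm_sym => /perm_nilP /=.
  by case: E' {pE' nE' hp hs}.
have [c cE cmax] : exists2 c, c \in E & forall d, d \in E -> d.1 <= c.1.
  case: E szE {IH lek pE nE hp hf hs} => // e E _.
  elim: E e => [|f E IHE] e; first by exists e; rewrite ?inE // => d; rewrite inE => /eqP ->.
  have [c cE h] := IHE f.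
  case: (leqP c.1 e.1) => [le|/ltnW le].
    exists e; first by rewrite inE eqxx.
    by move=> d; rewrite inE => /orP[/eqP -> //|/h]; move/leq_trans; apply.
  exists c; first by rewrite inE cE orbT.
  by move=> d; rewrite inE => /orP[/eqP -> //|/h].
have: c.1 \in map fst E' by rewrite -(perm_mem hf) map_f.
case/mapP=> c' cE' cc'.
have cmax' d : d \in E' -> d.1 <= c.1.
  move=> dE; have: d.1 \in map fst E by rewrite (perm_mem hf) map_f.
  by case/mapP=> e eE ->; apply: cmax.
move: (perm_to_rem cE) (perm_to_rem cE'); set G := rem c E; set G' := rem c' E' => eG eG'.
rewrite (perm_proper_diagram eG) in pE; rewrite (perm_proper_diagram eG') in pE'.
have {}nE := perm_noncrossing eG nE; have {}nE' := perm_noncrossing eG' nE'.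
have {}hs : perm_eq (map snd (c :: G)) (map snd (c' :: G')).
  by rewrite -(permPl (perm_map snd eG)) -(permPr (perm_map snd eG')).
have {}hf : perm_eq (map fst (c :: G)) (map fst (c' :: G')).
  by rewrite -(permPl (perm_map fst eG)) -(permPr (perm_map fst eG')).
have {}cmax d : d \in G -> d.1 <= c.1 by move/mem_rem/cmax.
have {}cmax' d : d \in G' -> d.1 <= c'.1 by move/mem_rem/cmax'; rewrite cc'.
have szG : size G < k.
  by move: lek; rewrite (perm_size eG) /=.
clear cE cE'; clearbody G G'; move: c c' cc' G G' eG eG' pE pE' nE nE' hs hf cmax cmax' szG.
move=> [p q] [p' q'] /= <- G G' eG eG' pE pE' nE nE' hs hf mx mx' szG.
have [pq pq'] : p < q /\ p < q'.
  by case/andP: pE => _ /= /andP[-> _]; case/andP: pE' => _ /= /andP[-> _].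
have qq' : q = q'.
  apply/eqP; rewrite eqn_leq.
  rewrite (max_opener_closer pE nE mx) //=; last by rewrite (perm_mem hs) mem_head.
  by rewrite (max_opener_closer pE' nE' mx') //= -(perm_mem hs) mem_head.
move: hs hf; rewrite -qq' !perm_cons => hs hf.
rewrite (permPl eG) perm_sym (permPl eG') -qq' perm_cons perm_sym.
apply: IH => //; try exact: proper_cons pE; try exact: proper_cons pE';
  try exact: noncrossing_cons nE; try exact: noncrossing_cons nE'.
exact: perm_cat.
Qed.

(** * Recovering a multiset of diagrams from its evaluations *)

Section Uniqueness.
Variables (R : zmodType) (phi : diagram -> R) (D : diagram).
Hypothesis phi_perm : forall E E', perm_eq E E' -> phi E = phi E'.

Let ncm (F : diagram) : bool :=
  [&& proper_diagram F, noncrossing F & perm_eq (endpoints F) (endpoints D)].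

(** As [F] is lightest, triangularity kills every term except the copies of [F], each of value 1:
    one evaluation reads off a multiplicity. *)
Lemma chord_eval_class_sum F M : ncm F -> all ncm M ->
  (forall G, G \in M -> weight F <= weight G) ->
  (\sum_(G <- M) chord_eval (opens F) G)%R = (count (perm_eq F) M)%:R%R.
Proof.
move=> /and3P[pF nF eF] /allP hM hmin.
rewrite -sum1_count natr_sum [RHS]big_mkcond /= big_seq [RHS]big_seq.
apply: eq_bigr => G GM; case/and3P: (hM _ GM) => pG nG eG.
have eFG : perm_eq (endpoints F) (endpoints G) by rewrite (permPl eF) perm_sym.
case: ifP => [h|/negP h]; first by rewrite -(perm_chord_eval _ h) chord_eval_opens.
case: (eqVneq (chord_eval (opens F) G) 0%R) => // nz; case: h.
apply: noncrossing_openers => //; exact: chord_eval_opens_neq0 nz (hmin _ GM).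
Qed.

(** Induction on the total number of diagrams: a lightest one occurs equally often on both sides,
    and removing all its copies keeps the evaluations equal. *)
Lemma chord_eval_sum_inj M1 M2 : all ncm M1 -> all ncm M2 ->
  (forall s, (\sum_(F <- M1) chord_eval s F)%R = (\sum_(F <- M2) chord_eval s F)%R) ->
  (\sum_(F <- M1) phi F)%R = (\sum_(F <- M2) phi F)%R.
Proof.
have [k] := ubnP (size (M1 ++ M2)); elim: k M1 M2 => // k IH M1 M2 lek h1 h2 hs.
case: (posnP (size (M1 ++ M2))) => [/size0nil|sz].
  by case: M1 {lek h1 hs} => //; case: M2 {h2}.
have [F FM Fmin] : exists2 F, F \in M1 ++ M2 &
    forall G, G \in M1 ++ M2 -> weight F <= weight G.
  case: (M1 ++ M2) sz => // e E _ {IH lek h1 h2 hs}.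
  elim: E e => [|f E IHE] e; first by exists e; rewrite ?inE // => d; rewrite inE => /eqP ->.
  have [c cE h] := IHE f.
  case: (leqP (weight e) (weight c)) => [le|/ltnW le].
    exists e; first by rewrite inE eqxx.
    by move=> d; rewrite inE => /orP[/eqP -> //|/h]; apply: leq_trans.
  exists c; first by rewrite inE cE orbT.
  by move=> d; rewrite inE => /orP[/eqP -> //|/h].
have gF : ncm F.
  by move: FM; rewrite mem_cat => /orP[]; [apply: (allP h1) | apply: (allP h2)].
have m1 G : G \in M1 -> weight F <= weight G.
  by move=> h; apply: Fmin; rewrite mem_cat h.
have m2 G : G \in M2 -> weight F <= weight G.
  by move=> h; apply: Fmin; rewrite mem_cat h orbT.
have ec : count (perm_eq F) M1 = count (perm_eq F) M2.
  by move: (hs (opens F)); rewrite !chord_eval_class_sum // => /eqP; rewrite Num.Theory.eqr_nat => /eqP.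
(* Stated for any [psi], since it serves both for [phi] and for every [chord_eval s]. *)
have sum_split (T : zmodType) (psi : diagram -> T) M :
    (forall E E', perm_eq E E' -> psi E = psi E') ->
    (\sum_(G <- M) psi G = psi F *+ count (perm_eq F) M
       + \sum_(G <- [seq G <- M | ~~ perm_eq F G]) psi G)%R.
  move=> hpsi; rewrite (bigID (perm_eq F)) /= big_filter; congr (_ + _)%R.
  rewrite (eq_bigr (fun=> psi F)) => [|G /hpsi //].
  by rewrite big_const_seq; elim: (count _ _) => //= c ->; rewrite mulrS.
rewrite (sum_split _ _ M1 phi_perm) (sum_split _ _ M2 phi_perm) ec; congr (_ + _)%R.
apply: IH.
- rewrite -filter_cat size_filter -ltnS; apply: leq_trans lek; rewrite ltnS.
  rewrite -(count_predC (perm_eq F) (M1 ++ M2)) -[X in X < _]add0n ltn_add2r -has_count.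
  by apply/hasP; exists F.
- by apply/allP=> G; rewrite mem_filter => /andP[_]; apply/allP.
- by apply/allP=> G; rewrite mem_filter => /andP[_]; apply/allP.
- move=> s; have := hs s.
  by rewrite (sum_split _ _ M1 (@perm_chord_eval s)) (sum_split _ _ M2 (@perm_chord_eval s)) ec => /addrI.
Qed.

(** Diagrams are lists, so equality of the two multisets is expressed by testing against functions
    invariant under permutation of chords. *)
Lemma full_expansion_sum M1 M2 : proper_diagram D ->
  full_expansion D M1 -> full_expansion D M2 ->
  (\sum_(F <- M1) phi F)%R = (\sum_(F <- M2) phi F)%R.
Proof.
move=> pD; have ok M : full_expansion D M -> all ncm M.
  move=> h; apply/allP=> F FM; rewrite /ncm (full_expansion_proper h pD FM).
  by rewrite (full_expansion_endpoints h FM) (allP (full_expansion_noncrossing h) _ FM).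
move=> h1 h2; apply: chord_eval_sum_inj; try exact: ok.
by move=> s; rewrite -(full_expansion_chord_eval s h1) -(full_expansion_chord_eval s h2).
Qed.

End Uniqueness.

(** * Columns *)

Section Columns.
Variables m n : nat.

Definition stat (F : diagram) : nat :=
  eF (inY m n) F + eF (fun p => inX m p || inZ m n p) F.

Lemma perm_stat F F' : perm_eq F F' -> stat F = stat F'.
Proof. by move=> /permP h; rewrite /stat /eF !h. Qed.

Definition genf (M : seq diagram) : {poly int} := (\sum_(F <- M) 'X^(stat F))%R.

Lemma genf_cat M1 M2 : genf (M1 ++ M2) = (genf M1 + genf M2)%R.
Proof. exact: big_cat. Qed.

(** [fe_done] returns the very list it is given, so reordering the chords may change the output
    lists; [genf] does not notice. *)
Lemma full_expansion_perm E E' M : full_expansion E M -> perm_eq E E' ->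
  exists2 M', full_expansion E' M' & genf M' = genf M.
Proof.
move=> h; elim: h E' => {E M} [E nE|E rest a b c d M1 M2 hE ab bc cd h1 _ h2 _] E' hp.
  exists [:: E']; first by apply: fe_done; apply: perm_noncrossing nE.
  by rewrite /genf !big_seq1 (perm_stat hp).
exists (M1 ++ M2) => //; apply: (fe_step (rest := rest) _ ab bc cd) => //.
by rewrite perm_sym in hp; apply: perm_trans hE.
Qed.

(** Unlike the mere absence of a crossing, this condition over all chords [d] of a diagram depends
    only on the endpoints, so it survives expansions. *)
Definition outside (c d : chord) : bool :=
  ~~ (c.1 < d.1 < c.2) && ~~ (c.1 < d.2 < c.2).

(** No chord ever comes to cross [e], so [e] is carried unchanged into every resulting diagram. *)
Lemma full_expansion_ear E M e : full_expansion E M -> all (outside e) E ->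
  exists2 M', full_expansion (e :: E) M' &
    genf M' = ('X^(stat [:: e]) * genf M)%R.
Proof.
elim=> {E M} [E nE|E rest a b c d M1 M2 hE ab bc cd _ IH1 _ IH2] /allP he.
  exists [:: e :: E]; last first.
    rewrite /genf !big_seq1 -exprD; congr ('X^_)%R.
    by rewrite /stat /eF /=; lia.
  apply: fe_done; apply/allP=> c cE; apply/allP=> d dE; move: cE dE.
  rewrite !inE => /orP[/eqP ->|cE] /orP[/eqP ->|dE].
  - by rewrite /crosses ltnn.
  - by have := he _ dE; rewrite /outside /crosses; lia.
  - by have := he _ cE; rewrite /outside /crosses; lia.
  - exact: (mem_noncrossing nE).
have /allP : all (outside e) ((a, c) :: (b, d) :: rest).
  by rewrite -(perm_all _ hE); apply/allP.
move=> /allP /= /and3P[ac bd hr].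
have [|N1 f1 g1] := IH1 _.
  by rewrite /= hr; move: ac bd; rewrite /outside /=; lia.
have [|N2 f2 g2] := IH2 _.
  by rewrite /= hr; move: ac bd; rewrite /outside /=; lia.
(* [fe_step] wants the two new chords in front, where the induction hypothesis has [e]. *)
have rot3 (x y z : chord) : perm_eq [:: x, y, z & rest] [:: y, z, x & rest].
  by apply/permP=> P /=; lia.
have [N1' {}f1 g1'] := full_expansion_perm f1 (rot3 _ _ _).
have [N2' {}f2 g2'] := full_expansion_perm f2 (rot3 _ _ _).
exists (N1' ++ N2').
  apply: (fe_step (rest := e :: rest) _ ab bc cd f1 f2).
  apply: (@perm_trans _ (e :: (a, c) :: (b, d) :: rest)); first by rewrite perm_cons.
  exact: rot3.
by rewrite !genf_cat g1' g2' g1 g2; ring.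
Qed.

(* Column [j] is [(None, (z_j, y_j))] when [j] is not a row length, and
   [(Some (eps_i, i), (x_i, y_j or z_j))] when [j = a_i]. *)
Definition kind := option (bool * 'I_m).
Definition column := (kind * chord)%type.

Definition is_row (t : kind) : bool := if t is Some _ then true else false.
Definition is_xz (t : kind) : bool := if t is Some (true, _) then true else false.

(** Only the border between Z and Y is recorded, not the one between X and Z: turning a leading R0
    into F creates a free column that opens in X. *)
Definition column_ok (c : column) : bool :=
  if is_xz c.1 then (c.2.1 < c.2.2) && (c.2.2 < m + n)
  else (c.2.1 < m + n) && (m + n <= c.2.2) && (c.2.2 < m + 2 * n).

(* Relative position of a column [c] and a later column [d]: the points [x]
   decrease along the columns and precede all [z], the points [z] increase and
   precede all [y], and the points [y] decrease. *)
Definition column_before (c d : column) : bool :=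
  [&& if is_row d.1 then d.2.1 < c.2.1 else c.2.1 < d.2.1,
      if is_xz c.1 then c.2.2 < d.2.2 else d.2.2 < c.2.2,
      c.2.1 < d.2.2 &
      if is_xz c.1 && ~~ is_row d.1 then c.2.2 < d.2.1 else d.2.1 < c.2.2].

Definition rows (w : seq kind) : seq 'I_m := pmap (omap snd) w.

(** Distinct rows are required so that the sign of a leading row can be flipped without affecting
    the rest of the word. *)
Definition columns_ok (D : seq column) : bool :=
  [&& all column_ok D, pairwise column_before D & uniq (rows (map fst D))].

Lemma all_imp T (P Q R S : pred T) s :
  (forall c, P c -> Q c -> R c -> S c) -> all P s -> all Q s -> all R s -> all S s.
Proof.
move=> h; elim: s => //= c s IH /andP[pc ps] /andP[qc qs] /andP[rc rs].
by rewrite h // IH.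
Qed.

Ltac column_cases :=
  repeat match goal with c : column |- _ => destruct c as [[[[] ?]|] [? ?]] end;
  rewrite /outside /column_ok /column_before /=;
  repeat match goal with
  | |- is_true (_ && _) -> _ => case/andP
  | |- _ /\ _ -> _ => case
  | |- _ -> _ => intro
  end;
  repeat match goal with |- is_true (_ && _) => apply/andP; split end; lia.

(** The geometry of F R0 = R0 F + X R1: the crossing points are x < z < y' < y, one expansion swaps
    the columns, and the other leaves R1 and the ear (y', y). *)
Lemma columns_ok_free_xy u w i x y y' z (D := u ++ (Some (true, i), (x, z)) :: w) :
  columns_ok (u ++ (None, (z, y)) :: (Some (false, i), (x, y')) :: w) ->
  [/\ columns_ok D, all (outside (y', y)) (map snd D),
      columns_ok (u ++ (Some (false, i), (x, y)) :: (None, (z, y')) :: w)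
    & [&& x < z, z < y' & y' < y]].
Proof.
rewrite /columns_ok /D {D} !map_cat /rows !pmap_cat /= !all_cat /= !pairwise_cat /=.
rewrite !allrel_consr.
case/and3P=> /and4P[ku k1 k2 kw]
  /and4P[/and3P[r1 r2 ruw] pu /andP[b12 b1w] /andP[b2w pw]] hu.
have hc := conj k1 (conj k2 b12).
split.
- rewrite ku kw ruw pu pw hu !andbT /=; apply/and3P; split.
  + by clear -hc; move: hc; column_cases.
  + by apply: (all_imp _ ku r1 r2) => c; clear -hc; move: hc; column_cases.
  + by apply: (all_imp _ kw b1w b2w) => c; clear -hc; move: hc; column_cases.
- rewrite !all_map /=; apply/and3P; split.
  + by apply: (all_imp _ ku r1 r2) => c; clear -hc; move: hc; column_cases.
  + by clear -hc; move: hc; column_cases.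
  + by apply: (all_imp _ kw b1w b2w) => c; clear -hc; move: hc; column_cases.
- rewrite ku kw ruw pu pw hu !andbT /=; apply/andP; split.
    by apply/andP; split; clear -hc; move: hc; column_cases.
  apply/and3P; split; [|apply/andP; split|].
  + by rewrite andbC; apply/andP; split; apply: (all_imp _ ku r1 r2) => c; clear -hc; move: hc; column_cases.
  + by clear -hc; move: hc; column_cases.
  + by apply: (all_imp _ kw b1w b2w) => c; clear -hc; move: hc; column_cases.
  + by apply: (all_imp _ kw b1w b2w) => c; clear -hc; move: hc; column_cases.
- by clear -hc; move: hc; column_cases.
Qed.

(** The geometry of F R1 = R1 F + X R0, with crossing points x < z < z' < y and the ear (z, z'). *)
Lemma columns_ok_free_xz u w i x y z z' (D := u ++ (Some (false, i), (x, y)) :: w) :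
  columns_ok (u ++ (None, (z, y)) :: (Some (true, i), (x, z')) :: w) ->
  [/\ columns_ok D, all (outside (z, z')) (map snd D),
      columns_ok (u ++ (Some (true, i), (x, z)) :: (None, (z', y)) :: w)
    & [&& x < z, z < z' & z' < y]].
Proof.
rewrite /columns_ok /D {D} !map_cat /rows !pmap_cat /= !all_cat /= !pairwise_cat /=.
rewrite !allrel_consr.
case/and3P=> /and4P[ku k1 k2 kw]
  /and4P[/and3P[r1 r2 ruw] pu /andP[b12 b1w] /andP[b2w pw]] hu.
have hc := conj k1 (conj k2 b12).
split.
- rewrite ku kw ruw pu pw hu !andbT /=; apply/and3P; split.
  + by clear -hc; move: hc; column_cases.
  + by apply: (all_imp _ ku r1 r2) => c; clear -hc; move: hc; column_cases.
  + by apply: (all_imp _ kw b1w b2w) => c; clear -hc; move: hc; column_cases.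
- rewrite !all_map /=; apply/and3P; split.
  + by apply: (all_imp _ ku r1 r2) => c; clear -hc; move: hc; column_cases.
  + by clear -hc; move: hc; column_cases.
  + by apply: (all_imp _ kw b1w b2w) => c; clear -hc; move: hc; column_cases.
- rewrite ku kw ruw pu pw hu !andbT /=; apply/andP; split.
    by apply/andP; split; clear -hc; move: hc; column_cases.
  apply/and3P; split; [|apply/andP; split|].
  + by rewrite andbC; apply/andP; split; apply: (all_imp _ ku r1 r2) => c; clear -hc; move: hc; column_cases.
  + by clear -hc; move: hc; column_cases.
  + by apply: (all_imp _ kw b1w b2w) => c; clear -hc; move: hc; column_cases.
  + by apply: (all_imp _ kw b1w b2w) => c; clear -hc; move: hc; column_cases.
- by clear -hc; move: hc; column_cases.
Qed.

(** Later points of X precede [x] and all other later points follow [z], so a leading R1 chord is an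
    ear. *)
Lemma columns_ok_head_xz i x z w :
  columns_ok ((Some (true, i), (x, z)) :: w) ->
  [/\ columns_ok w, all (outside (x, z)) (map snd w) & i \notin rows (map fst w)].
Proof.
rewrite /columns_ok /= => /and3P[/andP[k kw] /andP[b pw] /andP[-> ->]].
rewrite kw pw; split=> //; rewrite all_map.
by apply: (all_imp _ kw b b) => c; clear -k; move: k; column_cases.
Qed.

(** [column_before] sees its first column only through [is_xz] and the positions, so a leading R0
    can be relabelled F with its chord unmoved. *)
Lemma columns_ok_head_xy i x y w :
  columns_ok ((Some (false, i), (x, y)) :: w) ->
  columns_ok ((None, (x, y)) :: w) /\ i \notin rows (map fst w).
Proof. by rewrite /columns_ok /= => /and3P[-> -> /andP[-> ->]]. Qed.

End Columns.

(** * Signed weights *)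

Section Weights.
Variable m : nat.
Implicit Types (s : {ffun 'I_m -> bool}) (w : seq (kind m)) (i : 'I_m).
Local Open Scope ring_scope.

Definition sgn s i : {poly int} := (-1) ^+ s i.

Definition kind_sum s (t : kind m) : {poly int} := if t is Some (_, i) then sgn s i else 0.

Definition kind_sgn s (t : kind m) : {poly int} :=
  if t is Some (true, i) then sgn s i else 1.

Definition row_sum s w : {poly int} := \sum_(t <- w) kind_sum s t.

(** The row sum runs over the rows ending at or after the current column, that is, over the boxes of
    that column. The extra sign of an R1 row selects odd parity once [s] is summed over. *)
Fixpoint sign_weight s w : {poly int} :=
  if w is t :: w' then (1 + 'X * row_sum s w) * kind_sgn s t * sign_weight s w' else 1.

Definition total_weight w : {poly int} := \sum_s sign_weight s w.

Lemma sgnM s i : sgn s i * sgn s i = 1.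
Proof. by rewrite -expr2 -exprM mulnC exprM sqrrN expr1n expr1n. Qed.

Lemma row_sum_cons s t w : row_sum s (t :: w) = kind_sum s t + row_sum s w.
Proof. exact: big_cons. Qed.

Lemma row_sum_cat s u w : row_sum s (u ++ w) = row_sum s u + row_sum s w.
Proof. exact: big_cat. Qed.

(** The factors of the prefix [u] depend on the suffix only through its row sum. *)
Lemma sign_weight_cat s u w1 w2 w3 (c : {poly int}) :
  row_sum s w2 = row_sum s w1 -> row_sum s w3 = row_sum s w1 ->
  sign_weight s w1 = sign_weight s w2 + c * sign_weight s w3 ->
  sign_weight s (u ++ w1) = sign_weight s (u ++ w2) + c * sign_weight s (u ++ w3).
Proof.
move=> e2 e3 e; elim: u => //= t u ->.
by rewrite !row_sum_cons !row_sum_cat e2 e3; ring.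
Qed.

(** Holds for each [s]: swapping the columns removes the sign of row [i] from the factor of the free
    column, and a further factor [sgn s i] toggles R0 and R1 because its square is 1. *)
Lemma total_weight_free u e i w :
  total_weight (u ++ None :: Some (e, i) :: w) =
  total_weight (u ++ Some (e, i) :: None :: w)
    + 'X * total_weight (u ++ Some (~~ e, i) :: w).
Proof.
rewrite /total_weight mulr_sumr -big_split; apply: eq_bigr => s _ /=.
apply: sign_weight_cat; rewrite /= ?row_sum_cons /= ?add0r //.
by have := sgnM s i; case: e => /= h; [ring: h | ring].
Qed.

Definition flip i s : {ffun 'I_m -> bool} := [ffun j => (j == i) (+) s j].

Lemma flipK i : involutive (flip i).
Proof. by move=> s; apply/ffunP=> j; rewrite !ffunE addbA addbb. Qed.

Lemma sgn_flip s i : sgn (flip i s) i = - sgn s i.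
Proof. by rewrite /sgn ffunE eqxx addTb signrN. Qed.

Lemma row_sum_flip s i w : i \notin rows w -> row_sum (flip i s) w = row_sum s w.
Proof.
elim: w => [|[[e j]|] w IH]; first by rewrite /row_sum !big_nil.
  rewrite /rows /= inE negb_or => /andP[ij iw]; rewrite !row_sum_cons IH //=.
  by rewrite /sgn ffunE eq_sym (negbTE ij).
by move=> iw; rewrite !row_sum_cons IH.
Qed.

Lemma sign_weight_flip s i w :
  i \notin rows w -> sign_weight (flip i s) w = sign_weight s w.
Proof.
elim: w => // t w IH iw; rewrite [LHS]/= row_sum_flip // IH /=; last first.
  by apply: contra iw; case: t => [[e j]|] //; rewrite /rows /= inE orbC => ->.
congr (_ * _ * _); case: t iw => [[[] j]|] //=.
by rewrite /rows /= inE negb_or => /andP[ij _]; rewrite /sgn ffunE eq_sym (negbTE ij).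
Qed.

Lemma sum_sgn_flip i (h : {ffun 'I_m -> bool} -> {poly int}) :
  (forall s, h (flip i s) = h s) -> \sum_s sgn s i * h s = 0.
Proof.
move=> hh; set S := (\sum_s _).
have: S = - S.
  rewrite {1}/S (reindex_inj (inv_inj (flipK i))) /= -sumrN.
  by apply: eq_bigr => s _; rewrite sgn_flip hh mulNr.
move/polyP=> e; apply/polyP=> k; move: (e k); rewrite coefN coef0; move: (S`_k) => v; lia.
Qed.

(** After expansion, the terms with an odd power of [sgn s i] cancel under flipping that sign; the
    square of the sign leaves ['X]. *)
Lemma total_weight_head_xz i w : i \notin rows w ->
  total_weight (Some (true, i) :: w) = 'X * total_weight w.
Proof.
move=> iw; rewrite /total_weight mulr_sumr.
pose h s := (1 + 'X * row_sum s w) * sign_weight s w.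
have h0 : \sum_s sgn s i * h s = 0.
  by apply: sum_sgn_flip => s; rewrite /h row_sum_flip // sign_weight_flip.
rewrite -[RHS]add0r -[X in _ = X + _]h0 -big_split /=; apply: eq_bigr => s _ /=.
by have := sgnM s i; rewrite /h row_sum_cons /= => e; ring: e.
Qed.

Lemma total_weight_head_xy i w : i \notin rows w ->
  total_weight (Some (false, i) :: w) = total_weight (None :: w).
Proof.
move=> iw; have h0 : \sum_s sgn s i * ('X * sign_weight s w) = 0.
  by apply: sum_sgn_flip => s; rewrite sign_weight_flip.
rewrite /total_weight -[RHS]add0r -[X in _ = X + _]h0 -big_split /=.
by apply: eq_bigr => s _ /=; rewrite !row_sum_cons /=; ring.
Qed.

Lemma total_weight_all_free w : all (fun t => ~~ is_row t) w ->
  total_weight w = (2 ^ m)%:R.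
Proof.
move=> hw; rewrite /total_weight (eq_bigr (fun=> 1)) => [|s _].
  by rewrite sumr_const card_ffun card_bool card_ord.
elim: w hw => //= -[//|] w IH hw; rewrite IH // mulr1 mulr1 row_sum_cons /= add0r.
rewrite (_ : row_sum s w = 0) ?mulr0 ?addr0 //.
elim: w hw {IH} => [|[//|] w IH hw]; first by rewrite /row_sum big_nil.
by rewrite row_sum_cons IH //= addr0.
Qed.

End Weights.


(** * Expanding a word of columns *)

Section Recursion.
Variables m n : nat.

(** The sum of the positions, counted from 1, of the row columns: the number of boxes of the Young
    diagram. Every rewriting rule lowers it. *)
Fixpoint area (w : seq (kind m)) : nat :=
  if w is t :: w' then size (rows w) + area w' else 0.

Lemma rows_cat (u w : seq (kind m)) : rows (u ++ w) = rows u ++ rows w.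
Proof. exact: pmap_cat. Qed.

Lemma area_cons t (w : seq (kind m)) : area (t :: w) = size (rows (t :: w)) + area w.
Proof. by []. Qed.

Lemma area_cat (u w : seq (kind m)) : area (u ++ w) = area u + size u * size (rows w) + area w.
Proof.
elim: u => // t u IH; rewrite cat_cons !area_cons IH -cat_cons rows_cat size_cat /=.
by lia.
Qed.

Variant column_shape : seq (column m) -> Prop :=
| AllFree D : all (fun c => ~~ is_row c.1) D -> column_shape D
| HeadRow e i p D : column_shape ((Some (e, i), p) :: D)
| FreeRow u p e i q D : column_shape (u ++ (None, p) :: (Some (e, i), q) :: D).

Lemma column_shapeP D : column_shape D.
Proof.
elim: D => [|[[[e i]|] p] D IH]; [exact: AllFree | exact: HeadRow |].
case: IH => {D} [D hD|e i q D|u p' e i q D].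
- exact: AllFree.
- exact: (@FreeRow [::]).
- exact: (@FreeRow (_ :: u)).
Qed.

Lemma free_columns_noncrossing (D : seq (column m)) : columns_ok n D ->
  all (fun c => ~~ is_row c.1) D -> noncrossing (map snd D) /\ stat m n (map snd D) = 0.
Proof.
case/and3P=> + + _; elim: D => [|[[//|] [p q]] D IH] //=.
rewrite {1}/column_ok /= => /andP[k kD] /andP[b pD] hD.
have [nc s0] := IH kD pD hD; split.
  have hb d : d \in map snd D -> (p < d.1) && (d.2 < q).
    case/mapP=> [[t [p' q']]] cD ->; have := allP b _ cD; have := allP hD _ cD.
    by case: t {cD} => //= _; rewrite /column_before /= => /and4P[-> ->].
  apply/allP=> c cE; apply/allP=> d dE; move: cE dE.
  rewrite !inE => /orP[/eqP ->|cE] /orP[/eqP ->|dE].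
  - by rewrite /crosses ltnn.
  - by have := hb _ dE; rewrite /crosses /=; lia.
  - by have := hb _ cE; rewrite /crosses /=; lia.
  - exact: (mem_noncrossing nc).
move: s0; rewrite /stat /eF /= => /eqP; rewrite addn_eq0 => /andP[/eqP -> /eqP ->].
by rewrite /inX /inY /inZ; move: k; clear; lia.
Qed.

Lemma perm_catCA_swap (T : eqType) (u w : seq T) c d :
  perm_eq (u ++ c :: d :: w) (d :: c :: u ++ w).
Proof.
rewrite (permPl (permEl (perm_catCA u [:: c; d] w))).
exact: permEl (perm_catCA [:: c] [:: d] (u ++ w)).
Qed.

(** Induction on [area], applying the same rule to the chords and to the weights. The factor [2 ^ m]
    counts the sign vectors. *)
Lemma full_expansion_columns (D : seq (column m)) : columns_ok n D ->
  exists2 M, full_expansion (map snd D) M &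
    ((2 ^ m)%:R * genf m n M = total_weight (map fst D))%R.
Proof.
have [k] := ubnP (area (map fst D)); elim: k D => // k IH D leD ok.
case: (column_shapeP D) leD ok => {D} [D hD|e i [p q] D|u [z y] e i [x p] D] leD ok.
- have [nc s0] := free_columns_noncrossing ok hD.
  exists [:: map snd D]; first exact: fe_done.
  by rewrite /genf big_seq1 s0 expr0 mulr1 total_weight_all_free // all_map.
(* Leading R1: an ear inside X and Z, contributing ['X]. *)
- case: e leD ok => leD ok.
    have [okD oD iD] := columns_ok_head_xz ok.
    have [|M fM gM] := IH D _ okD; first by move: leD; rewrite /= ; lia.
    have [M' fM' gM'] := full_expansion_ear m n fM oD.
    exists M' => //; rewrite gM' /= total_weight_head_xz // -gM mulrCA; congr (_ * _)%R.
    have : stat m n [:: (p, q)] = 1.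
      case/and3P: ok => /= /andP[+ _] _ _; rewrite /column_ok /stat /eF /inX /inY /inZ /=.
      by clear; lia.
    by move=> ->.
  (* Leading R0: the same chords are read with this column free. *)
  have [okD iD] := columns_ok_head_xy ok.
  have [|M fM gM] := IH _ _ okD; first by move: leD; rewrite /= /rows /=; lia.
  by exists M => //; rewrite gM /= total_weight_head_xy.
have zy : column_ok n ((None, (z, y)) : column m).
  by case/and3P: ok => /allP h _ _; apply: h; rewrite mem_cat !inE eqxx !orbT.
have xp : column_ok n ((Some (e, i), (x, p)) : column m).
  by case/and3P: ok => /allP h _ _; apply: h; rewrite mem_cat !inE eqxx !orbT.
move: leD; rewrite map_cat /= !area_cat /= /rows /= => leD.
(* F followed by R1: [M2] expands the swapped word, [M1] the word with the pair replaced by R0, the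
   ear (z, p) being put back afterwards. *)
case: e ok leD xp => ok leD xp.
  have [ok1 o1 ok2 /and3P[xz zp py]] := columns_ok_free_xz ok.
  have [|M1 f1 g1] := IH _ _ ok1.
    by move: leD; rewrite map_cat !area_cat /= /rows /=; lia.
  have [|M2 f2 g2] := IH _ _ ok2.
    by move: leD; rewrite map_cat !area_cat /= /rows /=; lia.
  have [M1' {}f1 g1'] := full_expansion_ear m n f1 o1.
  have [|M1'' {}f1 g1''] := full_expansion_perm m n f1
    (E' := (x, y) :: (z, p) :: map snd (u ++ D)).
    by rewrite !map_cat; exact: permEl (perm_catCA (_ :: _) [:: _] _).
  have [|M2' {}f2 g2'] := full_expansion_perm m n f2
    (E' := (x, z) :: (p, y) :: map snd (u ++ D)).
    by rewrite !map_cat; exact: permEl (perm_catCA _ [:: _; _] _).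
  exists (M2' ++ M1'').
    apply: (fe_step (rest := map snd (u ++ D)) _ xz zp py) => //.
    by rewrite !map_cat; exact: perm_catCA_swap.
  rewrite genf_cat mulrDr g2' g2 g1'' g1' mulrCA g1 map_cat /= total_weight_free map_cat /=.
  suff -> : stat m n [:: (z, p)] = 1 by [].
  by move: zp xp zy; rewrite /column_ok /stat /eF /inX /inY /inZ /=; clear; lia.
have [ok1 o1 ok2 /and3P[xz zp py]] := columns_ok_free_xy ok.
have [|M1 f1 g1] := IH _ _ ok1.
  by move: leD; rewrite map_cat !area_cat /= /rows /=; lia.
have [|M2 f2 g2] := IH _ _ ok2.
  by move: leD; rewrite map_cat !area_cat /= /rows /=; lia.
have [M1' {}f1 g1'] := full_expansion_ear m n f1 o1.
have [|M1'' {}f1 g1''] := full_expansion_perm m n f1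
    (E' := (x, z) :: (p, y) :: map snd (u ++ D)).
  by rewrite !map_cat; exact: permEl (perm_catCA (_ :: _) [:: _] _).
have [|M2' {}f2 g2'] := full_expansion_perm m n f2
    (E' := (x, y) :: (z, p) :: map snd (u ++ D)).
  by rewrite !map_cat; exact: permEl (perm_catCA _ [:: _; _] _).
exists (M1'' ++ M2').
  apply: (fe_step (rest := map snd (u ++ D)) _ xz zp py) => //.
  by rewrite !map_cat; exact: perm_catCA_swap.
rewrite genf_cat mulrDr g2' g2 g1'' g1' mulrCA g1 map_cat /= total_weight_free map_cat /=.
rewrite addrC; suff -> : stat m n [:: (p, y)] = 1 by [].
by move: py xp zy; rewrite /column_ok /stat /eF /inX /inY /inZ /=; clear; lia.
Qed.

End Recursion.

(** * The columns of the construction *)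

Lemma columns_ok_proper m n (D : seq (column m)) :
  columns_ok n D -> proper_diagram (map snd D).
Proof.
case/and3P=> + + _; rewrite /proper_diagram; elim: D => //= c D IH /andP[k kD] /andP[b pD].
have /andP[u ->] := IH kD pD; rewrite andbT.
have c12 : c.2.1 < c.2.2 by move: k; rewrite /column_ok; clear; case: ifP; lia.
rewrite c12 andbT.
have h e d : e \in [:: c.2.1; c.2.2] -> d \in endpoints (map snd D) -> e != d.
  rewrite /endpoints -!map_comp !inE mem_cat => he.
  case/orP=> /mapP[c' cD ->]; have := allP b _ cD; move: he;
    case: c {k b c12} c' {cD} => [[[[] i]|] [p q]] [[[[] j]|] [p' q']];
    rewrite /column_before /=; clear; lia.
have up : perm_eq (endpoints (c.2 :: map snd D)) (c.2.1 :: c.2.2 :: endpoints (map snd D)).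
  rewrite /endpoints /= perm_cons.
  exact: permEl (perm_catCA _ [:: _] _).
have := perm_uniq up; rewrite /= u inE negb_or andbT => ->.
rewrite neq_ltn c12 /=.
by apply/andP; split; apply/negP=> hc;
  [have := h c.2.1 _ _ hc | have := h c.2.2 _ _ hc];
  rewrite !inE !eqxx ?orbT => /(_ isT).
Qed.

Section Construction.
Variables (m n : nat) (a : seq nat) (eps : seq bool).
Hypothesis a_decr : forall i j : 'I_m, i < j -> nth 0 a j < nth 0 a i.
Hypothesis a_bound : forall i : 'I_m, 0 < nth 0 a i <= n.

(** Columns and rows count from 0 here, whereas the points count from 1; hence the successors. *)
Definition row_at (c : nat) : option 'I_m := [pick i : 'I_m | nth 0 a i == c.+1].

Definition column_of (c : nat) : column m :=
  if row_at c is Some i then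
    (Some (nth false eps i, i),
     (posX i.+1, if nth false eps i then posZ m c.+1 else posY m n c.+1))
  else (None, (posZ m c.+1, posY m n c.+1)).

Lemma a_inj (i j : 'I_m) : nth 0 a i = nth 0 a j -> i = j.
Proof.
by move=> e; case: (ltngtP i j) => [/a_decr|/a_decr|/val_inj //]; rewrite e ltnn.
Qed.

Lemma row_atP c i : (row_at c == Some i) = (nth 0 a i == c.+1).
Proof.
rewrite /row_at; case: pickP => [j /eqP hj|h]; last by rewrite h.
apply/eqP/eqP=> [[<-] //|hi]; congr Some; apply: a_inj; by rewrite hi.
Qed.

Lemma columns_of_ok : columns_ok n (map column_of (iota 0 n)).
Proof.
apply/and3P; split.
- apply/allP=> _ /mapP[c + ->]; rewrite mem_iota /column_of => /andP[_ cn].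
  case E: (row_at c) => [i|]; rewrite /column_ok /posX /posY /posZ /=; last first.
    by clear -cn; lia.
  have im := ltn_ord i; case: (nth false eps i); rewrite /=; clear -cn im; lia.
- rewrite pairwise_map.
  have: pairwise ltn (iota 0 n).
    by rewrite -sorted_pairwise ?iota_ltn_sorted //; exact: ltn_trans.
  apply: (sub_in_pairwise (P := mem (iota 0 n))); last exact/allP.
  move=> c d; rewrite /= ![_ \in _]mem_iota /= add0n => cn dn cd; rewrite /column_of.
  case Ec: (row_at c) => [i|]; case Ed: (row_at d) => [j|]; rewrite /column_before /=.
  (* The later column ends a longer row, which has the smaller index. *)
  + have ij : j < i.
      move/eqP: Ec; move/eqP: Ed; rewrite !row_atP => /eqP hj /eqP hi.
      rewrite ltnNge leq_eqVlt; apply/negP=> /orP[/eqP/val_inj eij|/a_decr].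
        by move: hj; rewrite -eij hi; lia.
      by rewrite hi hj; lia.
    have im := ltn_ord i; have jm := ltn_ord j.
    rewrite /posX /posY /posZ; case: (nth _ eps i); case: (nth _ eps j) => /=;
      clear -cn dn cd ij im jm; lia.
  + have im := ltn_ord i.
    rewrite /posX /posY /posZ; case: (nth _ eps i) => /=; clear -cn dn cd im; lia.
  + have jm := ltn_ord j.
    rewrite /posX /posY /posZ; case: (nth _ eps j) => /=; clear -cn dn cd jm; lia.
  + rewrite /posX /posY /posZ; clear -cn dn cd; lia.
- rewrite /rows -map_comp /=.
  have h c : omap snd (column_of c).1 = row_at c.
    by rewrite /column_of; case: (row_at c).
  have -> : pmap (omap snd) (map (fst \o column_of) (iota 0 n)) = pmap row_at (iota 0 n).
    by elim: (iota 0 n) => //= c s ->; rewrite h.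
  (* The length of a row recovers the column where it ends. *)
  apply: (pmap_uniq (g := fun i : 'I_m => (nth 0 a i).-1)); last exact: iota_uniq.
  by move=> c; case E: (row_at c) => [i|] //=; move/eqP: E; rewrite row_atP => /eqP ->.
Qed.

Hypothesis size_a : size a = m.

Lemma perm_columns_of : perm_eq (map snd (map column_of (iota 0 n))) (Eae m n a eps).
Proof.
have iotaS k : iota 1 k = map succn (iota 0 k) by rewrite (iotaDl 1 0).
have mem_a c : (c.+1 \in a) = (row_at c != None).
  apply/idP/idP => [/(nthP 0) [i + hi]|].
    rewrite size_a => im; apply/negP=> /eqP.
    by have := row_atP c (Ordinal im); rewrite hi eqxx => /eqP ->.
  case E: (row_at c) => [i|] // _; move/eqP: E; rewrite row_atP => /eqP <-.
  by rewrite mem_nth // size_a.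
rewrite -map_comp; set f := snd \o column_of; set P := fun c => c.+1 \in a.
have /(perm_map f) := permEl (perm_filterC P (iota 0 n)).
rewrite perm_sym => /permPl ->; rewrite map_cat; apply: perm_cat; last first.
  rewrite iotaS filter_map -map_comp;
    apply/permP=> Q; congr (count Q _); apply/eq_in_map => c /=.
  rewrite mem_filter => /andP[]; rewrite /predC /= /P mem_a negbK => /eqP h _.
  by rewrite /f /= /column_of h.
(* [Eae] lists these chords by rows, the word lists them by columns. *)
have hP : perm_eq [seq c <- iota 0 n | P c] [seq (nth 0 a i).-1 | i : 'I_m].
  apply: uniq_perm; first by rewrite filter_uniq ?iota_uniq.
    rewrite map_inj_in_uniq ?enum_uniq // => i j _ _ hij; apply: a_inj.
    by have := a_bound i; have := a_bound j; move: hij; clear; lia.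
  move=> c; rewrite mem_filter mem_iota /P mem_a; apply/idP/mapP.
    case E: (row_at c) => [i|] // _; exists i; first by rewrite mem_enum.
    by move/eqP: E; rewrite row_atP => /eqP ->.
  case=> i _ ->; case/andP: (a_bound i) => ai an; have : row_at (nth 0 a i).-1 == Some i.
    by rewrite row_atP prednK.
  by move/eqP => -> /=; move: ai an; clear; lia.
rewrite (permPl (perm_map f hP)) iotaS -val_enum_ord -!map_comp.
apply/permP=> Q; congr (count Q _); apply: eq_map => i /=; case/andP: (a_bound i) => ai _.
have /eqP h : row_at (nth 0 a i).-1 == Some i by rewrite row_atP prednK.
by rewrite /f /= /column_of h /= prednK.
Qed.

End Construction.

(** * Counting Young diagrams *)

Section Counting.
Variables (m n : nat) (a : seq nat) (eps : seq bool).
Hypothesis a_decr : forall i j : 'I_m, i < j -> nth 0 a j < nth 0 a i.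
Hypothesis a_bound : forall i : 'I_m, 0 < nth 0 a i <= n.
Implicit Types (s : {ffun 'I_m -> bool}) (phi : {ffun 'I_n -> option 'I_m}).
Local Open Scope ring_scope.

Definition kinds c l : seq (kind m) := [seq (column_of m n a eps j).1 | j <- iota c l].

Lemma big_row_at (R : Type) (idx : R) (op : Monoid.com_law idx) (F : 'I_m -> R) c :
  \big[op/idx]_(i < m | nth 0%N a i == c.+1) F i =
  if row_at m a c is Some i then F i else idx.
Proof.
case E: (row_at m a c) => [i|].
  rewrite (big_pred1 i) // => j.
  by rewrite -(row_atP a_decr) E eq_sym; apply/eqP/eqP => [[->]|->].
by rewrite big_pred0 // => j; rewrite -(row_atP a_decr) E.
Qed.

(** Stated for any commutative operation: the sums of signs and the products of signs both need
    it. *)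
Lemma big_longer_rows (R : Type) (idx : R) (op : Monoid.com_law idx) (F : 'I_m -> R) c :
  \big[op/idx]_(i < m | (c < nth 0%N a i)%N) F i =
  op (if row_at m a c is Some i then F i else idx)
     (\big[op/idx]_(i < m | (c.+1 < nth 0%N a i)%N) F i).
Proof.
rewrite -(big_row_at op) (bigID (fun i : 'I_m => nth 0%N a i == c.+1)) /=.
congr (op _ _); apply: eq_bigl => i; move: (nth 0%N a i) => x; clear; lia.
Qed.

Lemma no_longer_rows (R : Type) (idx : R) (op : Monoid.com_law idx) (F : 'I_m -> R) :
  \big[op/idx]_(i < m | (n < nth 0%N a i)%N) F i = idx.
Proof. by rewrite big_pred0 // => i; case/andP: (a_bound i) => _; rewrite ltnNge => ->. Qed.

Lemma row_sum_kinds s c l : (c + l)%N = n ->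
  row_sum s (kinds c l) = \sum_(i < m | (c < nth 0%N a i)%N) sgn s i.
Proof.
elim: l c => [c|l IH c]; rewrite ?addn0 ?addnS => hc.
  by rewrite hc no_longer_rows /row_sum big_nil.
rewrite big_longer_rows row_sum_cons -/(kinds c.+1 l) IH //=.
by rewrite /column_of; case: row_at.
Qed.

Lemma sign_weight_kinds s c l : (c + l)%N = n ->
  sign_weight s (kinds c l) =
  (\prod_(j <- iota c l) (1 + 'X * \sum_(i < m | (j < nth 0%N a i)%N) sgn s i))
   * \prod_(i < m | (c < nth 0%N a i)%N) sgn s i ^+ nth false eps i.
Proof.
elim: l c => [c|l IH c]; rewrite ?addn0 ?addnS => hc.
  by rewrite hc no_longer_rows big_nil mulr1.
have E : sign_weight s (kinds c l.+1) = (1 + 'X * row_sum s (kinds c l.+1)) *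
   kind_sgn s (column_of m n a eps c).1 * sign_weight s (kinds c.+1 l) by [].
rewrite E IH // row_sum_kinds ?addnS // [iota c l.+1](_ : _ = c :: iota c.+1 l) //.
rewrite big_cons [X in _ = _ * X]big_longer_rows.
rewrite -!mulrA; congr (_ * _); rewrite mulrCA; congr (_ * (_ * _)).
by rewrite /column_of; case: row_at => [i|] //=; case: (nth _ _ _).
Qed.

(** A filling with at most one 1 per column is encoded by [phi], giving for each column the row of
    its 1, or [None]. *)
Definition row_card phi (i : 'I_m) : nat := #|[set c | phi c == Some i]|.

Definition in_shape phi : bool :=
  [forall c : 'I_n, if phi c is Some i then (c < nth 0 a i)%N else true].

Definition filling phi : bool :=
  in_shape phi && [forall i, odd (row_card phi i) == nth false eps i].

Definition support phi : nat := #|[set c | phi c != None]|.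

(** Expanding the product means choosing in each column the term 1 or one box, which is a choice of
    [phi]. *)
Lemma prod_columns s :
  \prod_(c < n) (1 + 'X * \sum_(i < m | (c < nth 0%N a i)%N) sgn s i) =
  \sum_(phi | in_shape phi) 'X^(support phi) * \prod_i sgn s i ^+ row_card phi i.
Proof.
(* The value 0 outside the shape lets the expansion range over all [phi]. *)
pose G (c : 'I_n) (o : option 'I_m) : {poly int} :=
  if o is Some i then (if (c < nth 0%N a i)%N then 'X * sgn s i else 0) else 1.
transitivity (\prod_(c < n) \sum_o G c o).
  apply: eq_bigr => c _; rewrite (bigD1 None) //=; congr (_ + _).
  rewrite (reindex_omap Some id) /=; last by case.
  by rewrite mulr_sumr big_mkcond /=; apply: eq_big => // i; rewrite eqxx.
rewrite bigA_distr_bigA [RHS]big_mkcond; apply: eq_bigr => phi _ /=.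
case: ifPn => [/forallP h|]; last first.
  rewrite negb_forall => /existsP[c hc]; rewrite (bigD1 c) //= /G.
  by case: (phi c) hc => // i /negbTE ->; rewrite mul0r.
have -> : 'X^(support phi) = \prod_(c < n) (if phi c == None then 1 else 'X : {poly int}).
  rewrite /support -prodr_const big_mkcond /=; apply: eq_bigr => c _.
  by rewrite inE; case: (phi c).
have -> : \prod_i sgn s i ^+ row_card phi i =
    \prod_(c < n) (if phi c is Some i then sgn s i else 1).
  under eq_bigr do rewrite /row_card -prodr_const big_mkcond /=.
  rewrite exchange_big /=; apply: eq_bigr => c _; rewrite -big_mkcond /=.
  case E: (phi c) => [i|]; last by rewrite big_pred0 // => i; rewrite inE E.
  by rewrite (big_pred1 i) // => j; rewrite inE E eq_sym; apply/eqP/eqP => [[]|->].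
rewrite -big_split /=; apply: eq_bigr => c _; rewrite /G.
by have := h c; case: (phi c) => [i ->|_]; rewrite ?mul1r.
Qed.

(** The sum factors over the rows: a row gives 2 for an even exponent and 0 for an odd one. *)
Lemma sum_signs (k : 'I_m -> nat) :
  \sum_s \prod_i sgn s i ^+ k i = if [forall i, ~~ odd (k i)] then (2 ^ m)%:R else 0.
Proof.
rewrite -(bigA_distr_bigA (fun i (b : bool) => ((-1) ^+ b) ^+ k i : {poly int})) /=.
have E i : \sum_(b : bool) ((-1) ^+ b) ^+ k i = if odd (k i) then 0 else 2%:R :> {poly int}.
  rewrite big_bool /= expr1 expr0 expr1n -signr_odd.
  by case: odd; rewrite ?expr1 ?addNr ?expr0.
under eq_bigr do rewrite E.
case: ifPn => [/forallP h|].
  rewrite (eq_bigr (fun=> 2%:R)) => [|i _]; last by rewrite (negbTE (h i)).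
  by rewrite prodr_const card_ord natrX.
by rewrite negb_forall => /existsP[i]; rewrite negbK => hi; rewrite (bigD1 i) //= hi mul0r.
Qed.

Lemma total_weight_kinds :
  total_weight (kinds 0 n) = (2 ^ m)%:R * \sum_(phi | filling phi) 'X^(support phi).
Proof.
rewrite /total_weight.
under eq_bigr => s _.
  rewrite sign_weight_kinds //.
  rewrite -[X in iota _ X]subn0 -/(index_iota 0 n) big_mkord prod_columns mulr_suml.
  over.
rewrite exchange_big /= mulr_sumr big_mkcond [RHS]big_mkcond /=.
apply: eq_bigr => phi _; rewrite /filling; case: (in_shape phi) => //=.
(* The shift by [eps] turns the evenness test into the prescribed parity. *)
transitivity ('X^(support phi) * \sum_s \prod_i sgn s i ^+ (row_card phi i + nth false eps i)).
  rewrite mulr_sumr; apply: eq_bigr => s _; rewrite -mulrA; congr (_ * _).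
  rewrite [X in _ * X](eq_bigl predT) => [|i]; last by case/andP: (a_bound i).
  by rewrite -big_split; apply: eq_bigr => i _; rewrite exprD.
rewrite sum_signs mulrC.
have -> : [forall i, ~~ odd (row_card phi i + nth false eps i)] =
          [forall i, odd (row_card phi i) == nth false eps i].
  by apply: eq_forallb => i; rewrite oddD oddb; case: odd; case: nth.
by case: ifP => _; rewrite ?mul0r.
Qed.

Definition young_of phi : {ffun 'I_m * 'I_n -> bool} := [ffun b => phi b.2 == Some b.1].

Lemma gcount_fillings k :
  gcount m n a eps k = #|[set phi | filling phi && (support phi == k)]|.
Proof.
rewrite /gcount -(card_in_imset (f := young_of)); last first.
  move=> phi psi _ _ /ffunP e; apply/ffunP => c.
  case E: (phi c) => [i|]; first by have := e (i, c); rewrite !ffunE /= E eqxx => /esym/eqP.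
  case E': (psi c) => [i|] //; have := e (i, c); by rewrite !ffunE /= E E' eqxx.
have col phi (c : 'I_n) : (#|[set i | young_of phi (i, c)]| <= 1)%N.
  by apply/card_le1_eqP => i j; rewrite !inE !ffunE /= => /eqP -> /eqP[].
have row phi i : [set c | young_of phi (i, c)] = [set c | phi c == Some i].
  by apply/setP=> c; rewrite !inE ffunE.
have supp phi : #|[set b | young_of phi b]| = support phi.
  rewrite /support -!sum1_card big_mkcond [RHS]big_mkcond /=.
  rewrite (eq_bigr (fun b : 'I_m * 'I_n => (phi b.2 == Some b.1) : nat)); last first.
    by move=> b _; rewrite inE ffunE; case: eqP.
  rewrite -(pair_bigA _ (fun i c => (phi c == Some i) : nat)) exchange_big /=.
  apply: eq_bigr => c _; rewrite inE; case: (phi c) => [i|] /=; last by rewrite big1.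
  by rewrite (bigD1 i) //= eqxx big1 ?addn0 // => j /negbTE ji; rewrite eqE /= eq_sym ji.
have shape phi : [forall i : 'I_m, forall c : 'I_n,
    (nth 0 a i <= c)%N ==> ~~ young_of phi (i, c)] = in_shape phi.
  apply/forallP/forallP => [h c|h i].
    case E: (phi c) => [i|] //; have /forallP/(_ c) := h i.
    by rewrite ffunE /= E eqxx implybF -ltnNge.
  apply/forallP=> c; rewrite ffunE /=; have := h c.
  case: (phi c) => [j|_] /=; last by rewrite implybT.
  by case: (eqVneq (Some j) (Some i)) => [[->]|_ _]; rewrite ?implybT // implybF -ltnNge.
apply: eq_card => M; rewrite !inE; apply/idP/imsetP.
  case/and4P=> h1 /forallP h2 h3 h4.
  (* The inverse of [young_of]: the row picked is the only one, by the column condition [h2]. *)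
  pose phi := [ffun c : 'I_n => [pick i | M (i, c)]] : {ffun 'I_n -> option 'I_m}.
  have e : M = young_of phi.
    apply/ffunP=> -[i c]; rewrite !ffunE /=; case: pickP => [j hj|->] //.
    apply/idP/eqP => [hi|[<-] //]; congr Some.
    by have /card_le1_eqP := h2 c; apply; rewrite inE.
  exists phi => //; rewrite inE /filling -shape -supp -e h1 h4 andbT /=.
  apply/forallP=> i; have /forallP/(_ i) := h3.
  by rewrite {1}e row.
case=> phi; rewrite inE => /andP[/andP[h1 h2] h3] ->; apply/and4P; split.
- by rewrite shape.
- exact/forallP/col.
- by apply/forallP=> i; rewrite row; apply: (forallP h2).
- by rewrite supp.
Qed.

(** The factor [2 ^ m] cancels in the integral domain of polynomials, and the coefficients of ['X^k]
    are the two counts. *)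
Lemma fcount_fillings M k :
  (2 ^ m)%:R * genf m n M = total_weight (kinds 0 n) ->
  fcount m n M k = gcount m n a eps k.
Proof.
rewrite total_weight_kinds => e.
have {}e : genf m n M = \sum_(phi | filling phi) 'X^(support phi).
  by apply: mulfI e; rewrite -polyC_natr polyC_eq0 Num.Theory.pnatr_eq0 -lt0n expn_gt0.
have {}e : \sum_(F <- M) (stat m n F == k)%:R =
    \sum_(phi | filling phi) (support phi == k)%:R :> int.
  transitivity ((genf m n M)`_k).
    by rewrite coef_sum; apply: eq_bigr => F _; rewrite coefXn eq_sym.
  by rewrite e coef_sum; apply: eq_bigr => phi _; rewrite coefXn eq_sym.
apply/eqP; rewrite -(Num.Theory.eqr_nat int) gcount_fillings; apply/eqP.
rewrite /fcount -sum1_count -sum1_card !natr_sum big_mkcond /=.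
transitivity (\sum_(F <- M) (stat m n F == k)%:R : int).
  by apply: eq_bigr => F _; case: eqP.
rewrite e big_mkcond [RHS]big_mkcond /=.
by apply: eq_bigr => phi _; rewrite inE; case: filling => //=; case: eqP.
Qed.

End Counting.

(** * Equality of the two counts *)

Theorem theorem1 (m n : nat) (a : seq nat) (eps : seq bool) :
  0 < m -> m <= n ->
  size a = m -> size eps = m ->
  head 0 a = n -> sorted (fun x y => y < x) a -> all (fun x => 0 < x) a ->
  (exists M, full_expansion (Eae m n a eps) M) /\
  (forall M, full_expansion (Eae m n a eps) M ->
   forall k, k <= n -> fcount m n M k = gcount m n a eps k).
Proof.
move=> _ _ sa _ ha a_sorted a_pos.
have gt_trans : transitive (fun x y : nat => y < x).
  by move=> y x z xy yz; apply: ltn_trans xy.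
have a_decr (i j : 'I_m) : i < j -> nth 0 a j < nth 0 a i.
  by apply: (sorted_ltn_nth gt_trans 0 a_sorted); rewrite inE sa.
have a_bound (i : 'I_m) : 0 < nth 0 a i <= n.
  rewrite (allP a_pos) ?mem_nth ?sa //= -ha -nth0.
  have m_gt0 : 0 < m by exact: leq_ltn_trans (ltn_ord i).
  have [->//|i_gt0] := posnP i.
  exact: ltnW (a_decr (Ordinal m_gt0) i i_gt0).
have okD := columns_of_ok n eps a_decr.
have permD := perm_columns_of eps a_decr a_bound sa.
have properE : proper_diagram (Eae m n a eps).
  by rewrite -(perm_proper_diagram permD) (columns_ok_proper okD).
have [M0 f0 g0] := full_expansion_columns okD.
have [M1 f1 g1] := full_expansion_perm m n f0 permD.
split=> [|M fM k _]; first by exists M1.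
apply: fcount_fillings => //.
(* Independence of the choices replaces the given expansion by the one built from columns. *)
have -> : genf m n M = genf m n M1.
  by apply: full_expansion_sum fM f1 => // F F' /(perm_stat m n) ->.
by rewrite g1 g0 -map_comp.
Qed.
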